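(* The class of i-models has a minimal model: there exists an i-web $\mathbf{B}$ such that $\mathrm{Eq}(\mathbf{B}^+)$ is exactly the set of equations satisfied in all i-models, i.e. for all closed $\lambda$-terms $M,N$, the equation $M=N$ holds in $\mathbf{B}^+$ if and only if it holds in $\mathbf{A}^+$ for every i-web $\mathbf{A}$.
   Context: $\mathcal{P}_{\mathrm f}(A)$ is the set of finite subsets of $A$, and $\subseteq_{\mathrm f}$ means ''is a finite subset of''. An information system is a tuple $\mathcal{A}=(A,\mathrm{Con}_A,\vdash_A,\nu_A)$ where $A$ is a set (of tokens), $\nu_A\in A$, $\mathrm{Con}_A\subseteq\mathcal{P}_{\mathrm f}(A)$ is downward closed (under inclusion) and contains all singletons, and $\vdash_A\subseteq\mathrm{Con}_A\times A$ satisfies, writing $a\vdash_A b$ for ''$a\vdash_A\beta$ for all $\beta\in b$'': (I1) if $a\in\mathrm{Con}_A$ and $a\vdash_A b$ ($b$ finite), then $a\cup b\in\mathrm{Con}_A$; (I2) if $\alpha\in a\in \mathrm{Con}_A$, then $a\vdash_A\alpha$; (I3) if $a\vdash_A b$ and $b\vdash_A\gamma$, then $a\vdash_A\gamma$; (I4) $\emptyset\vdash_A\nu_A$. A subset $x\subseteq A$ is finitely consistent if all its finite subsets are in $\mathrm{Con}_A$; for such $x$, $x\!\downarrow_A=\{\alpha\in A:\exists a\subseteq_{\mathrm f}x,\ a\vdash_A\alpha\}$. A point of $\mathcal{A}$ is a set of the form $x\!\downarrow_A$; $\mathcal{A}^+$ is the set of points ordered by inclusion (a Scott domain). The exponential $\mathcal{A}\Rightarrow\mathcal{B}$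 has token set $\mathrm{Con}_A\times B$, distinguished token $(\emptyset,\nu_B)$; $\{(a_1,\beta_1),\dots,(a_k,\beta_k)\}$ is consistent iff for all $I\subseteq\{1,\dots,k\}$, $\bigcup_{i\in I}a_i\in\mathrm{Con}_A$ implies $\{\beta_i:i\in I\}\in\mathrm{Con}_B$; and $\{(a_1,\beta_1),\dots,(a_k,\beta_k)\}\vdash(c,\gamma)$ iff $\{\beta_i: c\vdash_A a_i\}\vdash_B\gamma$. A b-morphism $f:\mathcal{A}\to\mathcal{B}$ is a function $f:A\to B$ such that (Mo) for every finite $a\subseteq A$: $a\in\mathrm{Con}_A$ iff $f(a)\in\mathrm{Con}_B$ (where $f(a)$ is the image of $a$); (bMo) if $a\in\mathrm{Con}_A$, $\alpha\in A$ and $f(a)\vdash_B f(\alpha)$, then $a\vdash_A\alpha$. An i-web is a pair $\mathbf{A}=(\mathcal{A},\phi)$ where $\mathcal{A}$ is an information system and $\phi:(\mathcal{A}\Rightarrow\mathcal{A})\to\mathcal{A}$ is a b-morphism. The associated i-model $\mathbf{A}^+$ is $\mathcal{A}^+$ with the following interpretation of $\lambda$-terms, for environments $\rho:\mathrm{Var}\to\mathcal{A}^+$: $[\![x]\!]_\rho=\rho(x)$; $[\![\lambda y.M]\!]_\rho=\{\phi(a,\alpha): a\in\mathrm{Con}_A,\ \alpha\in[\![M]\!]_{\rho[y:=a\downarrow_A]}\}\!\downarrow_A$; $[\![MN]\!]_\rho=[\![M]\!]_\rho\cdot[\![N]\!]_\rho$, where for points $u,z$, $u\cdot z=\{\beta\in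 A:\exists a\subseteq_{\mathrm f}z,\ (a,\beta)\in\{(a',\beta'):\phi(a',\beta')\in u\}\!\downarrow_{A\Rightarrow A}\}$. This is a model of the untyped $\lambda$-calculus (a $\lambda$-model, coming from a reflexive object in the category of Scott domains). An equation $M=N$ between closed $\lambda$-terms holds in $\mathbf{A}^+$ if $[\![M]\!]=[\![N]\!]$ in $\mathbf{A}^+$; $\mathrm{Eq}(\mathbf{A}^+)$ is the set of all such equations. *)

(* Defs.v *)
From mathcomp Require Import all_boot.
From mathcomp Require Import boolp classical_sets functions cardinality.

Set Implicit Arguments.
Unset Strict Implicit.
Unset Printing Implicit Defensive.

Local Open Scope classical_set_scope.

(** * Information systems *)

(* [ent a x] is a |- x, a relation included in Con * token.  In [ent_trans] the
   hypothesis [con a] is only needed when [b] is empty: writing a |- b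
   presupposes that [a] is consistent. *)
Record infoSystem := InfoSystem {
  token :> Type;
  con : set (set token);
  ent : set token -> token -> Prop;
  nu : token;
  con_finite : forall a, con a -> finite_set a;
  con_down : forall a b, a `<=` b -> con b -> con a;
  con_set1 : forall x, con [set x];
  ent_con : forall a x, ent a x -> con a;
  con_ent : forall a b, con a -> finite_set b -> (forall x, b x -> ent a x) ->
    con (a `|` b);
  ent_refl : forall a x, con a -> a x -> ent a x;
  ent_trans : forall a b x, con a -> finite_set b ->
    (forall y, b y -> ent a y) -> ent b x -> ent a x;
  ent_nu : ent set0 nu }.

Arguments nu : clear implicits.

Definition ents (A : infoSystem) (a b : set A) : Prop :=
  forall x, b x -> ent a x.

Definition finCon (A : infoSystem) (x : set A) : Prop :=
  forall a, finite_set a -> a `<=` x -> con a.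

Definition down (A : infoSystem) (x : set A) : set A :=
  [set t | exists a, [/\ finite_set a, a `<=` x & ent a t]].

Definition isPoint (A : infoSystem) (u : set A) : Prop :=
  exists x, finCon x /\ u = down x.

Definition pointOf (A : infoSystem) := {u : set A | isPoint u}.

Definition conSet (A : infoSystem) := {a : set A | con a}.

Section InfoSystemTheory.
Variable A : infoSystem.
Implicit Types (a b c x u : set A) (t : A).

Lemma con0 : con (set0 : set A).
Proof. by apply: (con_down _ (con_set1 (nu A))). Qed.

Lemma ent_mono a b t : a `<=` b -> con b -> ent a t -> ent b t.
Proof.
move=> ab cb eat; have ca := ent_con eat.
by apply: (ent_trans cb (con_finite ca) _ eat) => y /ab; apply: ent_refl.
Qed.

Lemma con_fin a : con a -> finCon a.
Proof. by move=> ca b _ ba; apply: con_down ca. Qed.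

Lemma sub_down x : finCon x -> x `<=` down x.
Proof.
move=> cx t xt; exists [set t]; split; first exact: finite_set1.
  by move=> _ ->.
by apply: ent_refl => //; apply: con_set1.
Qed.

Lemma down_mono x y : x `<=` y -> down x `<=` down y.
Proof.
by move=> xy t [a [fa ax eat]]; exists a; split=> //; apply: subset_trans xy.
Qed.

(* A finite part of the closure of x is entailed by a finite part of x. *)
Lemma down_finite x b : finCon x -> finite_set b -> b `<=` down x ->
  exists a, [/\ finite_set a, a `<=` x, con a & ents a b].
Proof.
move=> cx fb bx.
have /choice[h hP] : forall t, exists a, b t ->
    [/\ finite_set a, a `<=` x & ent a t].
  move=> t; have [bt|nbt] := pselect (b t); last by exists set0.
  by have [a aP] := bx _ bt; exists a.
have fa : finite_set (\bigcup_(t in b) h t).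
  by apply: bigcup_finite => // t /hP[].
have ax : \bigcup_(t in b) h t `<=` x by move=> t [s /hP[_ + _]]; apply.
exists (\bigcup_(t in b) h t); split=> //; first exact: cx.
move=> t bt; have [_ _ eht] := hP _ bt.
by apply: ent_mono eht; [exact: bigcup_sup|exact: cx].
Qed.

Lemma down_finCon x : finCon x -> finCon (down x).
Proof.
move=> cx b fb bx; have [a [fa ax ca ab]] := down_finite cx fb bx.
by apply: (con_down _ (con_ent ca fb ab)); apply: subsetUr.
Qed.

Lemma down_closed x b t : finCon x -> b `<=` down x -> ent b t -> down x t.
Proof.
move=> cx bx ebt; have fb := con_finite (ent_con ebt).
have [a [fa ax ca ab]] := down_finite cx fb bx.
by exists a; split=> //; apply: ent_trans ebt.
Qed.

Lemma isPointP u : isPoint u <->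
  finCon u /\ (forall b t, b `<=` u -> ent b t -> u t).
Proof.
split=> [[x [cx ->]]|[cu clu]].
  split; first exact: down_finCon.
  by move=> b t; apply: down_closed.
exists u; split=> //; rewrite eqEsubset; split; first exact: sub_down.
by move=> t [a [_ au eat]]; apply: clu eat.
Qed.

Lemma isPoint_down x : finCon x -> isPoint (down x).
Proof. by exists x. Qed.

End InfoSystemTheory.

Definition principal (A : infoSystem) (a : conSet A) : pointOf A :=
  exist _ _ (isPoint_down (con_fin (proj2_sig a))).

(** * The exponential *)

Section Exponential.
Variables A B : infoSystem.

Definition expToken : Type := (conSet A * B)%type.

Definition expCon (s : set expToken) : Prop :=
  finite_set s /\
  forall t, t `<=` s -> con (\bigcup_(p in t) proj1_sig p.1) ->
    con [set p.2 | p in t].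

Definition expEnt (s : set expToken) (q : expToken) : Prop :=
  expCon s /\
  ent [set p.2 | p in [set p | s p /\ ents (proj1_sig q.1) (proj1_sig p.1)]]
      q.2.

Definition expNu : expToken := (exist _ set0 (con0 A), nu B).

Lemma expCon_at s (c : set A) : expCon s -> con c ->
  con [set p.2 | p in [set p | s p /\ ents c (proj1_sig p.1)]].
Proof.
move=> [fs cs] cc; apply: cs; first by move=> p [].
set b := \bigcup_(p in _) _.
have fb : finite_set b.
  apply: bigcup_finite; first by apply: sub_finite_set fs => p [].
  by move=> p _; exact: con_finite (proj2_sig p.1).
apply: (con_down _ (con_ent cc fb _)); first exact: subsetUr.
by move=> x [p [_ ep] /ep].
Qed.

Lemma expCon_finite s : expCon s -> finite_set s.
Proof. by case. Qed.

Lemma expCon_down s t : s `<=` t -> expCon t -> expCon s.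
Proof.
move=> st [ft ct]; split; first exact: sub_finite_set ft.
by move=> r rs; apply: ct; apply: subset_trans st.
Qed.

Lemma expCon_set1 q : expCon [set q].
Proof.
split; first exact: finite_set1.
move=> t tq _; apply: (con_down _ (con_set1 q.2)).
by move=> _ [p /tq -> <-].
Qed.

Lemma expEnt_con s q : expEnt s q -> expCon s.
Proof. by case. Qed.

Lemma expCon_ent s b : expCon s -> finite_set b ->
  (forall q, b q -> expEnt s q) -> expCon (s `|` b).
Proof.
move=> cs fb sb; have fs := expCon_finite cs.
split; first by rewrite finite_setU.
move=> t tsb; set c := \bigcup_(p in t) _ => cc.
have cd := expCon_at cs cc; set d := [set _ | _ in _] in cd.
have tc p : t p -> ents c (proj1_sig p.1).
  by move=> tp x px; apply: ent_refl => //; exists p.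
have ft : finite_set [set p.2 | p in t].
  by apply: finite_image; apply: sub_finite_set tsb _; rewrite finite_setU.
apply: (con_down _ (con_ent cd ft _)); first exact: subsetUr.
move=> _ [p tp <-]; case: (tsb _ tp) => [sp|bp].
  by apply: ent_refl => //; exists p => //; split=> //; exact: tc.
have [_] := sb _ bp; apply: ent_mono => //.
move=> _ [r [sr er] <-]; exists r => //; split=> // x rx.
by apply: ent_trans (er _ rx) => //; [exact: con_finite (proj2_sig p.1)|exact: tc].
Qed.

Lemma expEnt_refl s q : expCon s -> s q -> expEnt s q.
Proof.
move=> cs sq; split=> //; apply: ent_refl.
  by apply: expCon_at => //; exact: (proj2_sig q.1).
exists q => //; split=> // x; apply: ent_refl; exact: (proj2_sig q.1).
Qed.

Lemma expEnt_trans s b q : expCon s -> finite_set b ->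
  (forall p, b p -> expEnt s p) -> expEnt b q -> expEnt s q.
Proof.
move=> cs fb sb [cb bq]; split=> //.
have cq := proj2_sig q.1.
have cd := expCon_at cs cq.
apply: ent_trans bq => //; first exact: con_finite (expCon_at cb cq).
move=> _ [p [bp ep] <-]; have [_] := sb _ bp; apply: ent_mono => //.
move=> _ [r [sr er] <-]; exists r => //; split=> // x rx.
by apply: ent_trans (er _ rx) => //; exact: con_finite (proj2_sig p.1).
Qed.

Lemma expEnt_nu : expEnt set0 expNu.
Proof.
split; last by apply: ent_mono (ent_nu B) => //; apply: expCon_at; [|exact: con0];
  apply: expCon_down (expCon_set1 expNu).
exact: expCon_down (expCon_set1 expNu).
Qed.

Definition expSystem : infoSystem :=
  @InfoSystem expToken expCon expEnt expNu expCon_finite expCon_down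
    expCon_set1 expEnt_con expCon_ent expEnt_refl expEnt_trans expEnt_nu.

End Exponential.

(** * b-morphisms and i-webs *)

Definition bMorphism (A B : infoSystem) (f : A -> B) : Prop :=
  (forall a : set A, finite_set a -> (con a <-> con (f @` a))) /\
  (forall (a : set A) (t : A), con a -> ent (f @` a) (f t) -> ent a t).

Record iWeb := IWeb {
  web :> infoSystem;
  phi : expSystem web web -> web;
  phi_bMorphism : bMorphism phi }.

(** * Lambda-terms *)

(* Raw terms with named variables; alpha-conversion is not built in. *)
Inductive term : Type :=
| Var of nat
| App of term & term
| Lam of nat & term.

Fixpoint fv (M : term) : seq nat :=
  match M with
  | Var x => [:: x]
  | App M N => fv M ++ fv N
  | Lam y M => [seq x <- fv M | x != y]
  end.

Definition closedTerm (M : term) : bool := fv M == [::].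

(** * Interpretation in the i-model of an i-web *)

Section Interpretation.
Variable A : iWeb.

Definition env := nat -> pointOf A.

Definition upd (rho : env) (y : nat) (u : pointOf A) : env :=
  fun x => if x == y then u else rho x.

(* For z a point: finite subsets of a point are consistent, so quantifying over [conSet A]
   covers all finite subsets of z. *)
Definition appPoint (u z : set A) : set A :=
  [set t | exists a : conSet A, proj1_sig a `<=` z /\
     down [set p : expSystem A A | u (phi p)] (a, t)].

(* Values are given as underlying sets; see [interp_point]. *)
Fixpoint interp (M : term) (rho : env) : set A :=
  match M with
  | Var x => proj1_sig (rho x)
  | App M N => appPoint (interp M rho) (interp N rho)
  | Lam y M =>
      down [set s | exists a t,
        interp M (upd rho y (principal a)) t /\ s = phi ((a, t) : expSystem A A)]
  end.

Lemma appPoint_mono u u' z z' : u `<=` u' -> z `<=` z' ->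
  appPoint u z `<=` appPoint u' z'.
Proof.
move=> uu zz t [a [az h]]; exists a; split; first exact: subset_trans zz.
by apply: down_mono h => p /=; apply: uu.
Qed.

Lemma interp_mono M (rho rho' : env) :
  (forall x, proj1_sig (rho x) `<=` proj1_sig (rho' x)) ->
  interp M rho `<=` interp M rho'.
Proof.
elim: M rho rho' => [x|M IHM N IHN|y M IHM] rho rho' le /=; first exact: le.
  by apply: appPoint_mono; [exact: IHM|exact: IHN].
apply: down_mono => _ [a [t [ht ->]]]; exists a, t; split=> //.
by apply: IHM ht => x; rewrite /upd; case: eqP => _ //; exact: le.
Qed.

Lemma isPoint_appPoint u z : isPoint u -> isPoint z -> isPoint (appPoint u z).
Proof.
move=> /isPointP[cu _] /isPointP[cz _]; have [Mo _] := phi_bMorphism A.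
set U : set (expSystem A A) := [set p | u (phi p)].
have cU : finCon U.
  move=> s fs sU; apply/(Mo s fs); apply: cu; first exact: finite_image.
  by move=> _ [p /sU up <-].
have common b : finite_set b -> b `<=` appPoint u z -> exists a : conSet A,
    proj1_sig a `<=` z /\ forall t, b t -> down U (a, t).
  move=> fb bz.
  have /choice[h hP] : forall t, exists a : conSet A, b t ->
      proj1_sig a `<=` z /\ down U (a, t).
    move=> t; have [bt|nbt] := pselect (b t); last by exists (exist _ _ (con0 A)).
    by have [a aP] := bz _ bt; exists a.
  have sz : \bigcup_(t in b) proj1_sig (h t) `<=` z.
    by move=> x [t /hP[+ _]]; apply.
  have cs : con (\bigcup_(t in b) proj1_sig (h t)).
    apply: cz => //; apply: bigcup_finite => // t _.
    exact: con_finite (proj2_sig (h t)).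
  exists (exist _ _ cs); split=> //= t bt; have [_ Uht] := hP _ bt.
  apply: (@down_closed _ _ [set (h t, t) : expSystem A A]) => //.
    by move=> _ ->.
  split; first exact: expCon_set1.
  apply: ent_refl => /=.
    by apply: (@expCon_at A A _ _ (expCon_set1 _) cs).
  exists (h t, t) => //; split=> // x hx; apply: ent_refl => //=.
  by exists t.
apply/isPointP; split=> [b fb bz|b t bz ebt].
  have [a [az aP]] := common b fb bz.
  have cp : con [set ((a, t) : expSystem A A) | t in b].
    apply: (down_finCon cU); first exact: finite_image.
    by move=> _ [t bt <-]; exact: aP.
  have [_ /(_ _ (@subset_refl _ _))] := cp; rewrite image_comp /= image_id.
  by apply; apply: con_down (proj2_sig a) => x [_ [t _ <-]].
have cb := ent_con ebt; have fb := con_finite cb.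
have [a [az aP]] := common b fb bz; exists a; split=> //.
have sub : [set ((a, t) : expSystem A A) | t in b] `<=` down U.
  by move=> _ [s bs <-]; exact: aP.
apply: (down_closed cU sub).
have cp : expCon [set ((a, t) : expSystem A A) | t in b].
  by apply: (down_finCon cU) => //; apply: finite_image.
split=> //; apply: ent_mono ebt; last exact: (expCon_at cp (proj2_sig a)).
move=> s bs; exists (a, s) => //; split; first by exists s.
by move=> x /=; apply: ent_refl; exact: (proj2_sig a).
Qed.

Lemma interp_point M rho : isPoint (interp M rho).
Proof.
elim: M rho => [x|M IHM N IHN|y M IHM] rho /=; first exact: (proj2_sig (rho x)).
  exact: isPoint_appPoint.
apply: isPoint_down => F fF FX; have [Mo _] := phi_bMorphism A.
have /choice[h hP] : forall s, exists p : expSystem A A, F s ->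
    interp M (upd rho y (principal p.1)) p.2 /\ s = phi p.
  move=> s; have [Fs|nFs] := pselect (F s); last by exists (nu _).
  by have [a [t aP]] := FX _ Fs; exists (a, t).
have -> : F = [set phi p | p in h @` F].
  rewrite eqEsubset; split=> [s Fs|_ [_ [s Fs <-] <-]].
    by exists (h s); [exists s|case: (hP _ Fs)].
  by case: (hP _ Fs) => _ <-.
have fhF : finite_set (h @` F) by exact: finite_image.
apply/(Mo _ fhF); split=> // t tF cc; set c := \bigcup_(p in _) _ in cc.
have /isPointP[cM _] := IHM (upd rho y (principal (exist _ c cc))).
apply: cM; first by apply: finite_image; apply: sub_finite_set fhF.
move=> _ [p tp <-]; have [s Fs hs] := tF _ tp.
have [+ _] := hP _ Fs; rewrite hs; apply: interp_mono => x.
rewrite /upd; case: eqP => _ //; apply: down_mono.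
by move=> z pz; exists p.
Qed.

Lemma interp_fv M (rho rho' : env) :
  (forall x, x \in fv M -> rho x = rho' x) -> interp M rho = interp M rho'.
Proof.
elim: M rho rho' => [x|M IHM N IHN|y M IHM] rho rho' /= eqr.
- by rewrite eqr ?inE.
- by rewrite (IHM _ rho') ?(IHN _ rho') // => x xM; apply: eqr;
    rewrite mem_cat xM ?orbT.
congr down; rewrite eqEsubset.
by split=> _ [a [t [ht ->]]]; exists a, t; split=> //; move: ht;
  rewrite (IHM _ (upd rho' y (principal a))) // => x xM; rewrite /upd;
  case: eqP => // /eqP xy; apply: eqr; rewrite mem_filter xy.
Qed.

Lemma interp_closed M (rho rho' : env) :
  closedTerm M -> interp M rho = interp M rho'.
Proof. by move=> /eqP M0; apply: interp_fv => x; rewrite M0. Qed.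

End Interpretation.

(* Used for closed M and N, whose values do not depend on the environment by
   [interp_closed]. *)
Definition eqHolds (A : iWeb) (M N : term) : Prop :=
  forall rho : env A, interp M rho = interp N rho.

(* Main.v *)
(** For every equation that fails in some i-model choose a web refuting it, and
    let S be the disjoint sum of the chosen webs A_i, consistent and entailing
    componentwise.  The maps phi_i give a partial b-morphism on the exponential
    of S, which is completed freely to a web B: fresh tokens are added for the
    remaining exponential tokens, with no entailment beyond membership.  For
    closed M the value of M in A_i is the trace on A_i of its value in B.  One
    inclusion holds because A_i embeds in B.  For the other, the tokens of B are
    read as intersection types realized by points of A_i: an arrow token (a, b)
    is realized by d if d.w realizes b whenever w realizes a.  This is a logical
    relation, whatever the consistency predicate of B, so B refutes every
    equation refuted by some A_i. *)

From mathcomp Require Import all_boot.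
From mathcomp Require Import boolp classical_sets functions cardinality.
Require Import Defs.

Set Implicit Arguments.
Unset Strict Implicit.
Unset Printing Implicit Defensive.

Local Open Scope classical_set_scope.

(** * Finite sets, images and injectivity *)

Lemma finite_sub_image (T U : Type) (f : T -> U) (s : set T) (F : set U) :
  finite_set F -> F `<=` f @` s ->
  exists G, [/\ finite_set G, G `<=` s & F = f @` G].
Proof.
move=> fF Fs.
have [[y0 Fy0]|F0] := pselect (exists y, F y); last first.
  exists set0; split=> //.
  by rewrite image_set0 eqEsubset; split=> // y Fy; case: F0; exists y.
have [x0 _ _] := Fs _ Fy0.
have /choice[h hP] : forall y, exists x, F y -> s x /\ f x = y.
  move=> y; have [Fy|nFy] := pselect (F y); last by exists x0.
  by have [x sx fx] := Fs _ Fy; exists x.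
exists (h @` F); split; first exact: finite_image.
  by move=> _ [y /hP[sy _] <-].
rewrite eqEsubset; split=> [y Fy|_ [_ [y Fy <-] <-]].
  by exists (h y); [exists y|case: (hP _ Fy)].
by case: (hP _ Fy) => _ ->.
Qed.

Lemma inj_image_eq (T U : Type) (f : T -> U) (s t : set T) : injective f ->
  f @` s = f @` t -> s = t.
Proof.
move=> fi st; rewrite eqEsubset.
by split=> x; rewrite -!(image_inj fi) st.
Qed.

Lemma finite_inj_image (T U : Type) (f : T -> U) (s : set T) : injective f ->
  finite_set (f @` s) -> finite_set s.
Proof.
move=> fi fs; apply: sub_finite_set (@preimage_image _ _ f s) _.
by apply: finite_preimage fs => x y _ _ /fi.
Qed.

Lemma conSet_eq (A : infoSystem) (a b : conSet A) :
  proj1_sig a = proj1_sig b -> a = b.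
Proof. by case: a b => [a ca] [b cb] /= ab; apply: eq_exist. Qed.

(** * Embeddings of information systems and the induced maps of exponentials *)

Section ConsistencyEmbedding.
Variables A B : infoSystem.

(** Consistency must be preserved and reflected because it occurs on both sides of the implication
    defining [expCon]; entailment is only pushed forward. *)
Record conEmbedding (e : A -> B) : Prop := ConEmbedding {
  emb_con : forall a, finite_set a -> con a <-> con (e @` a);
  emb_ent : forall a t, ent a t -> ent (e @` a) (e t) }.

Variable (e : A -> B) (he : conEmbedding e).

Lemma emb_conSet (a : conSet A) : con (e @` proj1_sig a).
Proof.
apply/(emb_con he); [exact: con_finite (proj2_sig a)|exact: (proj2_sig a)].
Qed.

Definition expMap (q : expSystem A A) : expSystem B B :=
  (exist _ _ (emb_conSet q.1), e q.2).

Lemma expMap_inj : injective e -> injective expMap.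
Proof.
move=> ie [a x] [b y] [ab /ie ->]; congr (_, _); apply: conSet_eq.
by apply: (inj_image_eq ie).
Qed.

Lemma expMap_fst (F : set (expSystem A A)) :
  \bigcup_(p in expMap @` F) proj1_sig p.1 =
  e @` \bigcup_(p in F) proj1_sig p.1.
Proof. by rewrite bigcup_image image_bigcup. Qed.

Lemma expMap_snd (F : set (expSystem A A)) :
  [set p.2 | p in expMap @` F] = e @` [set p.2 | p in F].
Proof. by rewrite !image_comp. Qed.

Lemma expCon_expMap (F : set (expSystem A A)) : finite_set F ->
  con F <-> con (expMap @` F).
Proof.
have bc (G : set (expSystem A A)) :
    finite_set G -> finite_set (\bigcup_(p in G) proj1_sig p.1).
  move=> fG; apply: bigcup_finite => // -[a x] _.
  exact: con_finite (proj2_sig a).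
move=> fF; split=> [[_ cF]|[_ cF]].
  split; first exact: finite_image.
  move=> t tF; have ft := sub_finite_set tF (finite_image _ fF).
  have [G [fG GF ->]] := finite_sub_image ft tF.
  rewrite expMap_fst expMap_snd => /(emb_con he (bc _ fG)) cc.
  by apply/(emb_con he); [exact: finite_image|exact: cF].
split=> // G GF cc; have fG := sub_finite_set GF fF.
apply/(emb_con he); first exact: finite_image.
rewrite -expMap_snd; apply: cF; first exact: image_subset.
by rewrite expMap_fst; apply/(emb_con he) => //; exact: bc.
Qed.

Lemma expEnt_expMap (F : set (expSystem A A)) q :
  ent F q -> ent (expMap @` F) (expMap q).
Proof.
move=> [cF eF]; have cF' : con (expMap @` F).
  by apply/expCon_expMap => //; exact: expCon_finite cF.
split=> //; apply: ent_mono (emb_ent he eF).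
  move=> _ [_ [p [Fp ep] <-] <-]; exists (expMap p) => //.
  split; first by exists p.
  by move=> _ [x px <-]; apply: (emb_ent he); exact: ep.
exact: expCon_at cF' (emb_conSet q.1).
Qed.

End ConsistencyEmbedding.

(* A partial b-morphism from [expSystem base base] to [base], given as a span
   so that no function has to be defined off its domain. *)
Record partialWeb := PartialWeb {
  base : infoSystem;
  pdom : Type;
  pin : pdom -> expSystem base base;
  pphi : pdom -> base;
  pin_inj : injective pin;
  pphi_con : forall s, finite_set s -> con (pin @` s) <-> con (pphi @` s);
  pphi_ent : forall s w, con (pin @` s) -> ent (pphi @` s) (pphi w) ->
    ent (pin @` s) (pin w) }.

Lemma existT_inj (I : Type) (T : I -> Type) i : injective (existT T i).
Proof.
move=> x y xy; have := projT2_eq xy.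
by rewrite (Prop_irrelevance (projT1_eq xy) erefl).
Qed.

(** * Sums of webs *)

Section Part.
Variables (I : Type) (T : I -> Type).

Definition part i (s : set {i & T i}) : set (T i) := existT T i @^-1` s.
Arguments part : clear implicits.

Lemma finite_part i s : finite_set s -> finite_set (part i s).
Proof. by apply: finite_preimage => x y _ _; apply: existT_inj. Qed.

Lemma part_image i s : part i (existT T i @` s) = s.
Proof.
rewrite eqEsubset; split=> [x [y sy yx]|x sx]; last by exists x.
by rewrite -(existT_inj yx).
Qed.

Lemma part_image_neq i j s : i <> j -> part j (existT T i @` s) = set0.
Proof.
move=> ij; rewrite eqEsubset; split=> // x [y _ xy].
by case: ij; exact: (projT1_eq xy).
Qed.

End Part.

Arguments part {I T} i s.

Section SumSystem.
Variables (I : Type) (A : I -> infoSystem) (i0 : I).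
Let T := {i & A i}.

Definition sumCon (s : set T) : Prop :=
  finite_set s /\ forall i, con (part i s).

Definition sumEnt (s : set T) (t : T) : Prop :=
  sumCon s /\ ent (part (projT1 t) s) (projT2 t).

Lemma sumCon_finite s : sumCon s -> finite_set s. Proof. by case. Qed.

Lemma sumCon_down s t : s `<=` t -> sumCon t -> sumCon s.
Proof.
move=> st [ft ct]; split; first exact: sub_finite_set ft.
by move=> i; apply: con_down (ct i) => x; apply: st.
Qed.

Lemma sumCon_inj i a : finite_set a ->
  con a <-> sumCon (existT (fun i => A i) i @` a).
Proof.
move=> fa; split=> [ca|[_ /(_ i)]]; last by rewrite part_image.
split=> [|j]; first exact: finite_image.
have [<-|ij] := pselect (i = j); first by rewrite part_image.
by rewrite part_image_neq //; exact: con0.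
Qed.

Lemma sumCon_set1 t : sumCon [set t].
Proof.
case: t => i x; rewrite -image_set1; apply/sumCon_inj; first exact: finite_set1.
exact: con_set1.
Qed.

Lemma sumEnt_con s t : sumEnt s t -> sumCon s. Proof. by case. Qed.

Lemma sumCon_ent s b : sumCon s -> finite_set b ->
  (forall t, b t -> sumEnt s t) -> sumCon (s `|` b).
Proof.
move=> [fs cs] fb sb; split; first by rewrite finite_setU.
move=> i; apply: (con_ent (cs i)) => [|x bx]; first exact: finite_part.
by case: (sb _ bx).
Qed.

Lemma sumEnt_refl s t : sumCon s -> s t -> sumEnt s t.
Proof. by move=> cs st; split=> //; apply: ent_refl; [case: cs|case: t st]. Qed.

Lemma sumEnt_trans s b t : sumCon s -> finite_set b ->
  (forall t, b t -> sumEnt s t) -> sumEnt b t -> sumEnt s t.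
Proof.
move=> cs fb sb [_ ebt]; split=> //.
apply: (ent_trans (proj2 cs _) _ _ ebt) => [|x bx]; first exact: finite_part.
by case: (sb _ bx).
Qed.

Lemma sumEnt_nu : sumEnt set0 (existT _ i0 (nu (A i0))).
Proof.
split; first by apply: sumCon_down (sumCon_set1 (existT _ i0 (nu (A i0)))).
exact: ent_nu.
Qed.

Definition sumSystem : infoSystem :=
  @InfoSystem T sumCon sumEnt _ sumCon_finite sumCon_down sumCon_set1
    sumEnt_con sumCon_ent sumEnt_refl sumEnt_trans sumEnt_nu.

Lemma sum_emb i : @conEmbedding (A i) sumSystem (existT (fun i => A i) i).
Proof.
split=> [a|a t eat]; first exact: sumCon_inj.
have ca := ent_con eat; split; last by rewrite /= part_image.
by apply/sumCon_inj => //; exact: con_finite ca.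
Qed.

End SumSystem.

Section SumWeb.
Variables (I : Type) (A : I -> iWeb) (i0 : I).
Let S := sumSystem (fun i => A i) i0.
Let W := {i & expSystem (A i) (A i)}.

Definition sumIn (w : W) : expSystem S S :=
  expMap (sum_emb (fun i => A i) i0 (projT1 w)) (projT2 w).

Definition sumPhi (w : W) : S := existT _ (projT1 w) (phi (projT2 w)).

Lemma sumIn_inj : injective sumIn.
Proof.
move=> [i q] [j r] qr.
(* The index is read off the value, since the argument set may be empty. *)
have ij : i = j by exact: (f_equal (fun p => projT1 p.2) qr).
case: _ / ij in r qr *; congr existT.
by apply: expMap_inj qr; exact: existT_inj.
Qed.

Lemma part_sumPhi i s : part i (sumPhi @` s) = @phi (A i) @` part i s.
Proof.
rewrite eqEsubset; split=> [x [[j q] sq]|_ [q sq <-]]; last by exists (existT _ i q).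
move=> jx; have ij := projT1_eq jx; rewrite /= in ij.
case: _ / ij in x jx *; exists q => //.
exact: (existT_inj jx).
Qed.

Lemma image_part i s :
  expMap (sum_emb (fun i => A i) i0 i) @` part i s `<=` sumIn @` s.
Proof. by move=> _ [q sq <-]; exists (existT _ i q). Qed.

(** Consistency in the sum is componentwise for arguments and for values, so tokens of different
    summands never conflict. *)
Lemma con_sumIn s : finite_set s ->
  con (sumIn @` s) <-> forall i, con (part i s).
Proof.
move=> fs; split=> [cs i|cs].
  apply/(expCon_expMap (sum_emb (fun i => A i) i0 i)); first exact: finite_part.
  exact: con_down (@image_part i s) cs.
split=> [|t ts]; first exact: finite_image.
have [G [fG Gs ->]] := finite_sub_image (sub_finite_set ts (finite_image _ fs)) ts.
move=> [_ cG]; split=> [|i]; first by do 2!apply: finite_image.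
have [_ /(_ (part i G)) cGi] := cs i.
apply: con_down (cGi _ _) => [x|q Gq|]; last 1 first.
- apply: con_down (cG i) => x [q Gq qx].
  by exists (sumIn (existT _ i q)); [exists (existT _ i q)|exists x].
- move=> [_ [[j q] Gq <-] jx]; have ij := projT1_eq jx; rewrite /= in ij.
  case: _ / ij in x jx *; exists q => //; exact: (existT_inj jx).
- exact: Gs.
Qed.

Lemma sumPhi_con s : finite_set s ->
  con (sumIn @` s) <-> con (sumPhi @` s).
Proof.
move=> fs; split=> [/(con_sumIn fs) cs|[_ cs]].
  split=> [|i]; first exact: finite_image.
  rewrite part_sumPhi; apply/(proj1 (phi_bMorphism (A i))) => //.
  exact: finite_part.
apply/con_sumIn => // i; apply/(proj1 (phi_bMorphism (A i))).
  exact: finite_part.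
by rewrite -part_sumPhi.
Qed.

(** Only the part of [s] in the summand of [w] matters for the entailment, and there (bMo) for that
    summand applies. *)
Lemma sumPhi_ent s w : con (sumIn @` s) -> ent (sumPhi @` s) (sumPhi w) ->
  ent (sumIn @` s) (sumIn w).
Proof.
case: w => i q cs [_]; rewrite part_sumPhi /= => eq.
apply: (ent_mono (@image_part i s) cs).
apply: (@expEnt_expMap _ _ _ (sum_emb (fun i => A i) i0 i)).
apply: (proj2 (phi_bMorphism (A i))) eq.
apply: (proj1 (con_sumIn _) cs).
exact: finite_inj_image sumIn_inj (con_finite cs).
Qed.

Definition sumWeb : partialWeb := PartialWeb sumIn_inj sumPhi_con sumPhi_ent.

End SumWeb.

(** * Free completion of a partial web *)

(* [Arr n l b] stands for the exponential token ({l 0, ..., l n.-1}, b); the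
   values of [l] from [n] on are junk. *)
Inductive tree (S : Type) : Type :=
| Leaf of S
| Arr (n : nat) of (nat -> tree S) & tree S.

Arguments Arr {S} n l b.

Definition args (S : Type) (n : nat) (l : nat -> tree S) : set (tree S) :=
  [set l k | k in [set k | k < n]].

Lemma finite_args (S : Type) n (l : nat -> tree S) : finite_set (args n l).
Proof. by apply: finite_image; exact: finite_II. Qed.

Lemma argsP (S : Type) (x0 : tree S) (a : set (tree S)) : finite_set a ->
  exists n l, a = args n l.
Proof.
move=> /(@finite_seqP {classic tree S})[s ->]; exists (size s), (nth x0 s).
rewrite eqEsubset; split=> [x /= /(nthP (x0 : {classic tree S}))[k ks <-]|_ [k ks <-]].
  by exists k.
exact: (@mem_nth {classic tree S}).
Qed.

Lemma Leaf_inj S : injective (@Leaf S). Proof. by move=> x y []. Qed.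

Fixpoint rank (S : Type) (t : tree S) : nat :=
  match t with
  | Leaf _ => 0
  | Arr n l b => (maxn (\max_(k < n) rank (l k)) (rank b)).+1
  end.

Section Completion.
Variable P : partialWeb.
Notation S := (base P).
Notation T := (tree S).
Implicit Types (s a b c : set T) (t : T).

Definition leaves s : set S := @Leaf S @^-1` s.

Lemma finite_leaves s : finite_set s -> finite_set (leaves s).
Proof. by apply: finite_preimage => x y _ _; apply: Leaf_inj. Qed.

Lemma leaves_image (x : set S) : leaves (@Leaf S @` x) = x.
Proof. by rewrite eqEsubset; split=> [y [z xz [<-]]//|y xy]; exists y. Qed.

(* Consequences of the leaves have to be included: a set of leaves containing no
   value of [pphi] may still entail one, which can clash with an [Arr] of s. *)
Definition arrows s : set (set T * T) :=
  [set f | (exists n l, s (Arr n l f.2) /\ f.1 = args n l) \/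
           (exists w : pdom P, [/\ down (leaves s) (pphi w),
              f.1 = @Leaf S @` proj1_sig (pin w).1 &
              f.2 = Leaf (pin w).2])].

Definition dom (F : set (set T * T)) : set T := \bigcup_(f in F) f.1.

(* The consistency condition of the exponential is contravariant in the
   arguments, so consistency is no fixpoint of a monotone operator; it is defined
   by recursion on a bound of the rank. *)
Fixpoint consAt n s : Prop :=
  con (leaves s) /\
  match n with
  | 0 => True
  | m.+1 => forall F, finite_set F -> F `<=` arrows s ->
      consAt m (dom F) -> consAt m (snd @` F)
  end.

Definition bounded n s := forall t, s t -> rank t <= n.

Lemma arrows_sub s s' : s `<=` s' -> arrows s `<=` arrows s'.
Proof.
move=> ss f [[n [l [sf fl]]]|[w [dw f1 f2]]].
  by left; exists n, l; split=> //; exact: ss.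
by right; exists w; split=> //; apply: down_mono dw => x; exact: ss.
Qed.

Lemma consAt_sub n s s' : s `<=` s' -> consAt n s' -> consAt n s.
Proof.
move=> ss; have ls : leaves s `<=` leaves s' by move=> x; exact: ss.
case: n => [|n] [cl cF]; (split; first exact: con_down ls cl) => //.
by move=> F fF Fs; apply: cF => //; apply: subset_trans (arrows_sub ss).
Qed.

Lemma args_rank n l k t : k < n -> rank (l k) < rank (Arr n l t).
Proof.
move=> kn; rewrite ltnS leq_max.
by rewrite (leq_bigmax (Ordinal kn) (F := fun k : 'I_n => rank (l k))).
Qed.

(** At [n = 0] only the arrows induced by [pphi] remain; their arguments and values are leaves, so
    the truncated [n.-1] is still a bound. *)
Lemma arrows_bounded n s f : bounded n s -> arrows s f ->
  bounded n.-1 f.1 /\ rank f.2 <= n.-1.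
Proof.
move=> bs [[m [l [sf ->]]]|[w [_ -> ->]]]; last by split=> // _ [x _ <-].
have := bs _ sf; case: n bs => // n bs /= lt; split.
  by move=> _ [k km <-]; exact: leq_trans (args_rank l f.2 km) lt.
by move: lt; rewrite ltnS geq_max => /andP[].
Qed.

Lemma dom_bounded n s F : bounded n s -> F `<=` arrows s ->
  bounded n.-1 (dom F) /\ bounded n.-1 (snd @` F).
Proof.
move=> bs Fs; split=> t.
  by move=> [f Ff]; exact: (proj1 (arrows_bounded bs (Fs _ Ff))).
by move=> [f Ff <-]; exact: (proj2 (arrows_bounded bs (Fs _ Ff))).
Qed.

Lemma consAt0 s : consAt 0 s <-> con (leaves s).
Proof. by split=> [[]|]. Qed.

(* At rank 0, (Mo) for the partial b-morphism gives the step. *)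
Lemma consAtS0 s : bounded 0 s -> consAt 0 s -> consAt 1 s.
Proof.
move=> bs [cs _]; split=> // F fF Fs.
pose g (w : pdom P) : set T * T :=
  (@Leaf S @` proj1_sig (pin w).1, Leaf (pin w).2).
have Fg : F `<=` g @` [set w | down (leaves s) (pphi w)].
  move=> [f1 f2] /Fs [[n [l [sf _]]]|[w [dw /= -> ->]]]; last by exists w.
  by have := bs _ sf.
have [G [fG Gs ->]] := finite_sub_image fF Fg.
have [_ cG] : con (@pin P @` G).
  apply/pphi_con => //; apply: (down_finCon (con_fin cs)); first exact: finite_image.
  by move=> _ [w Gw <-]; exact: Gs.
rewrite !consAt0.
have -> : leaves (dom (g @` G)) = \bigcup_(p in @pin P @` G) proj1_sig p.1.
  rewrite /dom !bigcup_image /= -(leaves_image (\bigcup_(i in G) _)).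
  by rewrite image_bigcup.
have -> : leaves (snd @` (g @` G)) = [set p.2 | p in @pin P @` G].
  by rewrite !image_comp -[RHS]leaves_image image_comp.
exact: cG.
Qed.

(** For a positive bound, domains and values of arrows have a smaller one, so the induction
    hypothesis, being an equivalence, applies on both sides of the implication. *)
Lemma consAtS n s : bounded n s -> consAt n s <-> consAt n.+1 s.
Proof.
elim: n s => [|n IH] s bs.
  by split; [exact: consAtS0|move=> [cs _]; split].
split=> -[cs cF]; split=> // F fF Fs; have [b1 b2] := dom_bounded bs Fs.
  by move=> /(IH _ b1) /(cF _ fF Fs) /(IH _ b2).
by move=> /(IH _ b1) /(cF _ fF Fs) /(IH _ b2).
Qed.

Lemma bounded_le n m s : n <= m -> bounded n s -> bounded m s.
Proof. by move=> nm bs t /bs /leq_trans; apply. Qed.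

Lemma consAt_le n m s : n <= m -> bounded n s -> consAt n s <-> consAt m s.
Proof.
move=> /subnKC <-; elim: (m - n) => [|k IH] bs; first by rewrite addn0.
rewrite addnS; apply: (iff_trans (IH bs)); apply: consAtS.
exact: bounded_le (leq_addr _ _) bs.
Qed.

Lemma finite_bounded s : finite_set s -> exists n, bounded n s.
Proof.
move=> /(finite_image (@rank S)) /finite_seqP[q sq].
exists (\max_(k <- q) k) => t st; apply: (@leq_bigmax_seq _ _ xpredT id) => //.
by have : (@rank S @` s) (rank t) by [exists t]; rewrite sq.
Qed.

Definition cCon s : Prop := finite_set s /\ exists2 n, bounded n s & consAt n s.

Lemma cCon_at n s : finite_set s -> bounded n s -> cCon s <-> consAt n s.
Proof.
move=> fs bn; split=> [[_ [m bm cm]]|cn]; last by split=> //; exists n.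
have [nm|/ltnW mn] := leqP n m; first exact/(consAt_le nm bn).
exact/(consAt_le mn bm).
Qed.

Lemma finite_dom s F : finite_set F -> F `<=` arrows s -> finite_set (dom F).
Proof.
move=> fF Fs; apply: bigcup_finite => // f /Fs [[n [l [_ ->]]]|[w [_ -> _]]].
  exact: finite_args.
by apply: finite_image; exact: con_finite (proj2_sig (pin w).1).
Qed.

(** The recursive equation without ranks: a bound [n] for [s] also bounds the domains and values of
    its arrows, so level [n.+1] unfolds to level [n]. *)
Lemma cConP s : finite_set s -> cCon s <->
  con (leaves s) /\ forall F, finite_set F -> F `<=` arrows s ->
    cCon (dom F) -> cCon (snd @` F).
Proof.
move=> fs; have [n bn] := finite_bounded fs.
have eqF F : finite_set F -> F `<=` arrows s ->
    (cCon (dom F) <-> consAt n (dom F)) /\ (cCon (snd @` F) <-> consAt n (snd @` F)).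
  move=> fF Fs; have [b1 b2] := dom_bounded bn Fs.
  split; apply: cCon_at; try exact: bounded_le (leq_pred n) _.
    exact: finite_dom Fs.
  exact: finite_image.
apply: (iff_trans (cCon_at fs (bounded_le (leqnSn n) bn))).
split=> -[cs cF]; split=> // F fF Fs; have [e1 e2] := eqF F fF Fs.
  by move=> /e1 /(cF _ fF Fs) /e2.
by move=> /e1 /(cF _ fF Fs) /e2.
Qed.

Definition cEnt s t : Prop :=
  cCon s /\ (s t \/ exists2 x, t = Leaf x & ent (leaves s) x).

Lemma cCon_finite s : cCon s -> finite_set s. Proof. by case. Qed.

Lemma cCon_leaves s : cCon s -> con (leaves s).
Proof. by move=> cs; have [] := proj1 (cConP (cCon_finite cs)) cs. Qed.

Lemma cCon_down s s' : s `<=` s' -> cCon s' -> cCon s.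
Proof.
move=> ss [fs [n bn cn]]; split; first exact: sub_finite_set fs.
by exists n; [move=> t /ss /bn|exact: consAt_sub cn].
Qed.

Lemma cEnt_con s t : cEnt s t -> cCon s. Proof. by case. Qed.

Lemma cEnt_leaf s x : cEnt s (Leaf x) -> ent (leaves s) x.
Proof.
move=> [/cCon_leaves cs [sx|[y [<-]//]]].
exact: ent_refl.
Qed.

(** Adjoining consequences adds no arrows: an [Arr] in [b] already lies in [s], and the leaves of
    [b] follow from those of [s], whose closure [arrows] takes into account. *)
Lemma cCon_ent s b : cCon s -> finite_set b ->
  (forall t, b t -> cEnt s t) -> cCon (s `|` b).
Proof.
move=> cs fb sb; have fs := cCon_finite cs.
have cl := cCon_leaves cs.
have lb x : leaves b x -> ent (leaves s) x by move=> /sb /cEnt_leaf.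
have clb : con (leaves (s `|` b)) := con_ent cl (finite_leaves fb) lb.
apply/cConP; first by rewrite finite_setU.
split=> // F fF Fs; apply: (proj2 (proj1 (cConP fs) cs)) => // f /Fs.
move=> [[n [l [[sf|/sb [_ [sf|[]//]]] fl]]]|[w [dw f1 f2]]].
- by left; exists n, l.
- by left; exists n, l.
right; exists w; split=> //.
apply: (down_closed (con_fin cl) (b := leaves (s `|` b))).
  move=> x [sx|/lb ex]; first exact: (sub_down (con_fin cl)).
  by exists (leaves s); split=> //; exact: con_finite cl.
by have [a [fa ale ea]] := dw; apply: ent_mono ea.
Qed.

Lemma cCon_Leaf (x : set S) : finite_set x -> con x <-> cCon (@Leaf S @` x).
Proof.
move=> fx; have bx : bounded 0 (@Leaf S @` x) by move=> _ [y _ <-].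
rewrite (cCon_at (finite_image _ fx) bx) consAt0 leaves_image.
by [].
Qed.

(** Besides its own arrow, a single [Arr] only has arrows from those [w] whose [pphi w] follows from
    the empty set; all values are then consequences of [b]. *)
Lemma cCon_set1 t : cCon [set t].
Proof.
elim: t => [x|n l IHl b IHb].
  rewrite -image_set1; apply/cCon_Leaf; first exact: finite_set1.
  exact: con_set1.
have l0 : leaves [set Arr n l b] = set0.
  by rewrite eqEsubset; split.
apply/cConP; first exact: finite_set1.
rewrite l0; split; first exact: con0.
move=> F fF Fs _.
apply: (cCon_down _ (cCon_ent IHb (finite_image snd fF) _)).
  exact: subsetUr.
move=> _ [f /Fs [[m [k [[_ _ ->] _]]]|[w [dw _ ->]]] <-].
  by split=> //; left.
split=> //; right; exists (pin w).2 => //.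
have [a [_ + ea]] := dw; rewrite l0 subset0 => a0; rewrite {}a0 in ea.
(* (bMo) of the partial map at the empty set: [pin w] follows from nothing, hence so does its
   value. *)
have [_] : ent (@pin P @` set0) (pin w).
  apply: pphi_ent; rewrite image_set0 //; exact: con0.
apply: ent_mono; last exact: cCon_leaves.
by move=> _ [p [[v []]]].
Qed.

Lemma cEnt_refl s t : cCon s -> s t -> cEnt s t.
Proof. by move=> cs st; split=> //; left. Qed.

Lemma cEnt_trans s b t : cCon s -> finite_set b ->
  (forall u, b u -> cEnt s u) -> cEnt b t -> cEnt s t.
Proof.
move=> cs fb sb [cb [/sb //|[x -> ex]]]; split=> //; right; exists x => //.
apply: (ent_trans (cCon_leaves cs) (finite_leaves fb) _ ex) => y.
by move=> /sb /cEnt_leaf.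
Qed.

Lemma cEnt_nu : cEnt set0 (Leaf (nu S)).
Proof.
split; first exact: cCon_down (cCon_set1 (Leaf (nu S))).
by right; exists (nu S) => //; exact: ent_nu.
Qed.

Definition completion : infoSystem :=
  @InfoSystem T cCon cEnt _ cCon_finite cCon_down cCon_set1 cEnt_con cCon_ent
    cEnt_refl cEnt_trans cEnt_nu.

Lemma Leaf_emb : @conEmbedding S completion (@Leaf S).
Proof.
split=> [a|a x ea]; first exact: cCon_Leaf.
have ca := ent_con ea; split.
  by apply/cCon_Leaf => //; exact: con_finite ca.
by right; exists x => //; rewrite leaves_image.
Qed.

End Completion.

(** * The total b-morphism on the completion *)

Section CompletionWeb.
Variable P : partialWeb.
Notation S := (base P).
Notation T := (tree S).
Notation C := (completion P).
Implicit Types (s : set (expSystem C C)) (q : expSystem C C).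

Definition liftExp : expSystem S S -> expSystem C C :=
  expMap (Leaf_emb P).

Lemma cPhi_ex q : exists t,
  (exists2 w, q = liftExp (pin w) & t = Leaf (pphi w)) \/
  ((forall w : pdom P, q <> liftExp (pin w)) /\
   exists n l, proj1_sig q.1 = args n l /\ t = Arr n l q.2).
Proof.
have [[w qw]|nq] := pselect (exists w : pdom P, q = liftExp (pin w)).
  by exists (Leaf (pphi w)); left; exists w.
have fq : finite_set (proj1_sig q.1) := con_finite (proj2_sig q.1).
have [n [l ql]] := argsP (Leaf (nu S)) fq.
exists (Arr n l q.2); right; split; last by exists n, l.
by move=> w qw; apply: nq; exists w.
Qed.

(** Choice fixes one enumeration of the arguments of each token outside the partial map. Since
    [args] gives the argument set back, the fresh tree determines the token. *)
Definition cPhi q : C :=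
  projT1 (cid (cPhi_ex q)).

Lemma liftExp_inj : injective liftExp.
Proof. by move=> p q; apply: expMap_inj; exact: Leaf_inj. Qed.

Lemma cPhiP q :
  (exists2 w, q = liftExp (pin w) & cPhi q = Leaf (pphi w)) \/
  (exists n l, proj1_sig q.1 = args n l /\ cPhi q = Arr n l q.2).
Proof. by rewrite /cPhi; case: cid => t /= [h|[_ h]]; [left|right]. Qed.

Lemma cPhi_lift w : cPhi (liftExp (pin w)) = Leaf (pphi w).
Proof.
rewrite /cPhi; case: cid => t /= [[v /liftExp_inj /pin_inj <- //]|[/(_ w)//]].
Qed.

Lemma cPhi_Arr q n l (b : T) : cPhi q = Arr n l b ->
  proj1_sig q.1 = args n l /\ q.2 = b.
Proof.
case: (cPhiP q) => [[w _ ->]//|[m [k [qk ->]]] [nm kl <-]].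
by rewrite qk; case: _ / nm kl => ->.
Qed.

Lemma liftExp_emb F : finite_set F -> con (@pin P @` F) <-> con (liftExp @` (@pin P @` F)).
Proof. by move=> fF; apply: expCon_expMap; apply: finite_image. Qed.

Definition pre s : set (pdom P) :=
  [set w | s (liftExp (pin w))].

Lemma finite_pre s : finite_set s -> finite_set (pre s).
Proof.
by apply: finite_preimage => w v _ _ /liftExp_inj /pin_inj.
Qed.

Lemma image_pre s : liftExp @` (@pin P @` pre s) `<=` s.
Proof. by move=> _ [_ [w sw <-] <-]. Qed.

Lemma leaves_cPhi s : leaves (cPhi @` s) = @pphi P @` pre s.
Proof.
rewrite eqEsubset; split=> [x [q sq]|_ [w sw <-]]; last first.
  by exists (liftExp (pin w)) => //; exact: cPhi_lift.
case: (cPhiP q) => [[w qw ->]|[n [l [_ ->]]]//] [<-].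
by exists w => //; rewrite /pre /= -qw.
Qed.

Lemma pre_ent s w : con s -> ent (@pphi P @` pre s) (pphi w) ->
  ent s (liftExp (pin w)).
Proof.
move=> cs ew; apply: (ent_mono (@image_pre s) cs); apply: expEnt_expMap.
apply: pphi_ent ew; apply/liftExp_emb; last exact: con_down (@image_pre s) cs.
exact: finite_pre (expCon_finite cs).
Qed.

(** If [cPhi q] is a leaf, (bMo) of the partial map applies through [pre_ent]. An [Arr] is entailed
    only as a member, and its preimage is unique. *)
Lemma cPhi_ent s q : con s -> ent (cPhi @` s) (cPhi q) -> ent s q.
Proof.
move=> cs [_]; rewrite leaves_cPhi.
have leaf x : cPhi q = Leaf x -> ent (@pphi P @` pre s) x -> ent s q.
  by case: (cPhiP q) => [[w -> ->] [<-]|[n [l [_ ->]]]//]; exact: pre_ent.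
case=> [[r sr rq]|[x qx ex]]; last exact: leaf ex.
case: (cPhiP q) => [[w _ qw]|[n [l [ql qA]]]].
  apply: (leaf _ qw); rewrite -leaves_cPhi; apply: ent_refl; last first.
    by exists r; rewrite // rq.
  rewrite leaves_cPhi; suff : con (@pin P @` pre s).
    by move=> /pphi_con; apply; exact: finite_pre (expCon_finite cs).
  apply/liftExp_emb; first exact: finite_pre (expCon_finite cs).
  exact: con_down (@image_pre s) cs.
rewrite qA in rq; have [rl rq2] := cPhi_Arr rq.
suff -> : q = r by exact: ent_refl.
rewrite [q]surjective_pairing [r]surjective_pairing rq2; congr (_, _).
by apply: conSet_eq; rewrite ql rl.
Qed.

(** Read as exponential tokens, the arrows of the image of [s] are consequences of [s], by [pre_ent]
    when they come from entailed leaves; conversely every member of [s] gives such an arrow. *)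
Lemma cPhi_con s : finite_set s -> con s <-> con (cPhi @` s).
Proof.
move=> fs; split=> [cs|/(cConP (finite_image _ fs))[cl cF]].
  have cl : con (leaves (cPhi @` s)).
    rewrite leaves_cPhi; apply/pphi_con; first exact: finite_pre.
    apply/liftExp_emb; first exact: finite_pre.
    exact: con_down (@image_pre s) cs.
  apply/(cConP (finite_image _ fs)); split=> // F fF Fs.
  pose g q : set T * T :=
    (proj1_sig q.1, q.2).
  have Fg : F `<=` g @` [set q | ent s q].
    move=> [f1 f2] /Fs [[n [l [[q sq]]]]|[w [dw /= -> ->]]].
      move=> /cPhi_Arr[qf1 qf2] /= f1E; exists q; first exact: (ent_refl cs sq).
      by rewrite /g /= qf1 qf2 f1E.
    exists (liftExp (pin w)) => //; apply: pre_ent => //.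
    have [a [_ ale ea]] := dw.
    by rewrite -leaves_cPhi; apply: ent_mono ea.
  have [G [fG Gs ->]] := finite_sub_image fF Fg.
  have [_ /(_ G)] := con_ent cs fG Gs.
  rewrite /dom bigcup_image image_comp; apply.
  exact: subsetUr.
split=> // t ts; have ft := sub_finite_set ts fs.
pose g q : set T * T :=
  (proj1_sig q.1, q.2).
have := cF (g @` t) (finite_image _ ft).
rewrite /dom bigcup_image image_comp; apply=> _ [q /ts sq <-].
case: (cPhiP q) => [[w qw qp]|[n [l [ql qA]]]].
  right; exists w; rewrite qw; split=> //; apply: (sub_down (con_fin cl)).
  by exists q.
by left; exists n, l; split=> //; exists q.
Qed.

Lemma cPhi_bMorphism : bMorphism cPhi.
Proof. by split=> [s|s q]; [exact: cPhi_con|exact: cPhi_ent]. Qed.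

Definition completionWeb : iWeb := IWeb cPhi_bMorphism.

End CompletionWeb.

(** * Comparison of interpretations *)

Section Web.
Variable A : iWeb.

Lemma appPoint_phi (u z : set A) (q : expSystem A A) :
  u (phi q) -> proj1_sig q.1 `<=` z -> appPoint u z q.2.
Proof.
case: q => a t uq az; exists a; split=> //.
exists [set (a, t) : expSystem A A]; split; first exact: finite_set1.
  by move=> _ ->.
exact: (ent_refl (con_set1 _)).
Qed.

Implicit Types (rho : env A) (c : nat -> conSet A).

Definition approx c rho := forall x, proj1_sig (c x) `<=` proj1_sig (rho x).

(** Finitely many approximations of [rho] have a common one, their pointwise union, which is
    consistent because it lies inside points. *)
Lemma approx_directed (T : Type) (F : set T) rho
    (Q : T -> (nat -> conSet A) -> Prop) : finite_set F ->
  (forall s c c', (forall x, proj1_sig (c x) `<=` proj1_sig (c' x)) ->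
     Q s c -> Q s c') ->
  (forall s, F s -> exists2 c, approx c rho & Q s c) ->
  exists2 c, approx c rho & forall s, F s -> Q s c.
Proof.
move=> fF Qmono FQ.
have /choice[h hP] : forall s, exists c, F s -> approx c rho /\ Q s c.
  move=> s; have [/FQ[c cr Qc]|nFs] := pselect (F s); first by exists c.
  by exists (fun=> exist _ set0 (con0 A)).
have hrho x : \bigcup_(s in F) proj1_sig (h s x) `<=` proj1_sig (rho x).
  by move=> t [s /hP[+ _]]; apply.
have ch x : con (\bigcup_(s in F) proj1_sig (h s x)).
  have /isPointP[cr _] := proj2_sig (rho x); apply: cr => //.
  by apply: bigcup_finite => // s _; exact: con_finite (proj2_sig (h s x)).
exists (fun x => exist _ _ (ch x)) => [x|s Fs]; first exact: hrho.
by have [_] := hP _ Fs; apply: Qmono => x t ht; exists s.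
Qed.

Lemma principal_sub (a : conSet A) (u : pointOf A) :
  proj1_sig a `<=` proj1_sig u -> proj1_sig (principal a) `<=` proj1_sig u.
Proof.
have /isPointP[_ clu] := proj2_sig u; move=> au t [b [_ ba ebt]].
by apply: clu ebt; exact: subset_trans au.
Qed.

Lemma interp_principal_mono M c c' :
  (forall x, proj1_sig (c x) `<=` proj1_sig (c' x)) ->
  interp M (fun x => principal (c x)) `<=` interp M (fun x => principal (c' x)).
Proof. by move=> cc; apply: interp_mono => x; exact: down_mono. Qed.

(** Continuity of the interpretation in the environment: each derivation of a token inspects
    finitely many tokens. *)
Lemma interp_finite M rho t : interp M rho t ->
  exists2 c, approx c rho & interp M (fun x => principal (c x)) t.
Proof.
pose none : conSet A := exist _ set0 (con0 A).
elim: M rho t => [x|M IHM N IHN|y M IHM] rho t /=.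
- move=> xt; exists (fun z => if z == x then exist _ _ (con_set1 t) else none).
    by move=> z; case: eqP => [->|_] s /=; [move=> ->|case].
  by rewrite eqxx; apply: (sub_down (con_fin (con_set1 t))).
- move=> [a [az [F [fF Fu eF]]]].
  (* The disjoint sum collects the tokens needed from [M] and from [N], so that one approximation
     serves both. *)
  pose G : set (A + A) := inl @` (@phi A @` F) `|` inr @` proj1_sig a.
  pose Q (s : A + A) c := match s with
    | inl s => interp M (fun x => principal (c x)) s
    | inr s => interp N (fun x => principal (c x)) s end.
  have fG : finite_set G.
    rewrite finite_setU; split; do ?apply: finite_image => //.
    exact: con_finite (proj2_sig a).
  have [|s Gs|c cr GQ] := @approx_directed _ G rho Q fG.
  + by move=> [s|s] c c' cc; exact: interp_principal_mono.
  + by case: Gs => -[r Fr <-]; [case: Fr => p /Fu /IHM + <-|exact: IHN (az _ Fr)].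
  exists c => //; exists a; split=> [s sa|]; first by apply: (GQ (inr s)); right; exists s.
  exists F; split=> // p Fp; apply: (GQ (inl (phi p))); left.
  by exists (phi p) => //; exists p.
move=> [F [fF Fu eF]].
pose Q s c := exists a t', interp M (upd (fun x => principal (c x)) y (principal a)) t'
  /\ s = phi ((a, t') : expSystem A A).
have [|s|c cr FQ] := @approx_directed _ F rho Q fF.
- move=> s c c' cc [a [t' [ct' st']]]; exists a, t'; split=> //.
  by apply: interp_mono ct' => x; rewrite /upd; case: eqP => _; apply: down_mono.
- move=> /Fu[a [t' [/IHM[c cP ct'] st']]].
  (* [c y] approximates the value bound to [y], not [rho y], so it is reset to the empty set; [upd]
     puts [a] back. *)
  exists (fun x => if x == y then none else c x) => [x|].
    by have := cP x; rewrite /upd; case: eqP => // _ _ s' [].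
  exists a, t'; split=> //; apply: interp_mono ct' => x.
  have := cP x; rewrite /upd; case: eqP => _ cx; last exact: subset_refl.
  exact: principal_sub.
by exists c => //; exists F.
Qed.

Lemma interp_Lam M rho y (q : expSystem A A) :
  interp M (upd rho y (principal q.1)) q.2 -> interp (Lam y M) rho (phi q).
Proof.
case: q => a t /= Mt; exists [set phi ((a, t) : expSystem A A)].
split; [exact: finite_set1|by move=> _ ->; exists a, t|].
exact: (ent_refl (con_set1 _)).
Qed.

(** Half of beta for points [w] that need not be principal: by continuity the body uses only a
    finite part [c y] of [w], and abstraction records its value there. *)
Lemma interp_beta M rho y (w : pointOf A) :
  interp M (upd rho y w) `<=` appPoint (interp (Lam y M) rho) (proj1_sig w).
Proof.
move=> t /interp_finite[c cP ct].
apply: (@appPoint_phi _ _ (c y, t)); last by have := cP y; rewrite /upd eqxx.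
apply: interp_Lam; apply: interp_mono ct => x.
have := cP x; rewrite /upd; case: eqP => [-> _|_]; first exact: subset_refl.
exact: principal_sub.
Qed.

End Web.

(** * Interpretations along an embedding commuting with [phi] *)

Section WebEmbedding.
Variables (A B : iWeb) (e : A -> B) (he : conEmbedding e).
Hypothesis phi_emb : forall q, phi (expMap he q) = e (phi q).

Lemma down_emb (u : set A) (v : set B) t :
  (forall x, u x -> v (e x)) -> down u t -> down v (e t).
Proof.
move=> uv [F [fF Fu eF]]; exists (e @` F); split; first exact: finite_image.
  by move=> _ [x /Fu ux <-]; exact: uv.
exact: emb_ent.
Qed.

Lemma interp_emb M (rho : env A) (rho' : env B) t :
  (forall x t, proj1_sig (rho x) t -> proj1_sig (rho' x) (e t)) ->
  interp M rho t -> interp M rho' (e t).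
Proof.
elim: M rho rho' t => [x|M IHM N IHN|y M IHM] rho rho' t /= le; first exact: le.
  move=> [a [az [F [fF Fu eF]]]].
  exists (expMap he (a, t)).1; split.
    by move=> _ [s /az Ns <-]; exact: IHN Ns.
  exists (expMap he @` F); split; first exact: finite_image.
    by move=> _ [p /Fu pu <-]; rewrite /= phi_emb; exact: IHM pu.
  exact: (@expEnt_expMap _ _ _ he F (a, t)).
apply: down_emb => _ [a [s [Ms ->]]].
exists (expMap he (a, s)).1, (e s); split; last by rewrite -phi_emb.
apply: IHM Ms => x r; rewrite /upd; case: eqP => _; last exact: le.
by apply: down_emb => z az; exists z.
Qed.

End WebEmbedding.

Lemma conEmbedding_comp (A B C : infoSystem) (f : B -> C) (e : A -> B) :
  conEmbedding f -> conEmbedding e -> conEmbedding (f \o e).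
Proof.
move=> hf he; split=> [a fa|a t eat].
  rewrite -image_comp; apply: (iff_trans (emb_con he fa)).
  by apply: (emb_con hf); exact: finite_image.
by rewrite -image_comp; apply: (emb_ent hf); exact: (emb_ent he).
Qed.

(** * Tokens of the completed sum as types realized in a summand *)

Section SumCompletion.
Variables (I : Type) (A : I -> iWeb) (i0 i : I).
Let P := sumWeb A i0.
Let B := completionWeb P.
Let D := A i.

Definition compEmb : D -> B := @Leaf (base P) \o existT (fun i => A i) i.

Lemma compEmb_emb : conEmbedding compEmb.
Proof. exact: conEmbedding_comp (Leaf_emb P) (sum_emb (fun i => A i) i0 i). Qed.

Lemma expMap_compEmb q : expMap compEmb_emb q =
  @liftExp P (@sumIn _ A i0 (existT (fun j => expSystem (A j) (A j)) i q)).
Proof. by congr (_, _); apply: conSet_eq; rewrite /= image_comp. Qed.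

(** Exponential tokens coming from [D] lie in the domain of the partial b-morphism, so [cPhi] sends
    them to leaves. *)
Lemma phi_compEmb q : phi (expMap compEmb_emb q) = compEmb (phi q).
Proof.
rewrite expMap_compEmb.
exact: (@cPhi_lift P (existT (fun j => expSystem (A j) (A j)) i q)).
Qed.

(* Tokens of B read as intersection types over the model of D: the i-th leaves
   are the basic tests, the leaves of the other summands are trivial. *)
Fixpoint realizes (t : tree {i & A i}) (d : set D) : Prop :=
  match t with
  | Leaf x => forall y, x = existT _ i y -> d y
  | Arr n l b => forall w : set D, isPoint w ->
      (forall k, k < n -> realizes (l k) w) -> realizes b (appPoint d w)
  end.

Definition realizesAll (u : set B) (d : set D) : Prop :=
  forall t, u t -> realizes t d.

Lemma realizes_mono t (d d' : set D) : d `<=` d' -> realizes t d -> realizes t d'.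
Proof.
elim: t d d' => [x|n l _ b IHb] d d' dd /= h; first by move=> y /h /dd.
by move=> w pw lw; apply: IHb (h w pw lw); exact: appPoint_mono.
Qed.

(** Arrows are entailed only as members; for leaves of summand [i], the point [d] is closed under
    entailment. *)
Lemma realizes_ent (a : set B) (t : B) d : isPoint d ->
  realizesAll a d -> ent a t -> realizes t d.
Proof.
move=> /isPointP[_ cld] ad [_ [/ad//|[x -> ex]]] y xy; subst x.
have [_ ey] := ex; apply: cld ey => z az.
exact: (ad _ az).
Qed.

Lemma realizes_down (a : set B) d : isPoint d ->
  realizesAll a d -> realizesAll (down a) d.
Proof.
move=> pd ad t [b [_ ba ebt]]; apply: realizes_ent ebt => // s /ba.
exact: ad.
Qed.

(** Arrow elimination. For an [Arr] it is the definition of [realizes]; for a leaf of summand [i] it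
    is application in [D]; for other summands the conclusion is vacuous. *)
Lemma realizes_phi (q : expSystem B B) (d w : set D) : isPoint w ->
  realizes (phi q) d -> realizesAll (proj1_sig q.1) w ->
  realizes q.2 (appPoint d w).
Proof.
rewrite {1}/phi /= => pw; case: (cPhiP q) => [[[j r] -> ->]|[n [l [ql ->]]]] /=.
  move=> dr rw y jy; have ij : j = i := projT1_eq jy.
  subst j; rewrite -(existT_inj jy); apply: appPoint_phi; first exact: dr.
  move=> x rx; refine (rw (Leaf (existT (fun j => A j) i x)) _ x erefl).
  by exists (existT (fun i => A i) i x) => //; exists x.
move=> dl qw; apply: dl => // k kn; apply: qw; rewrite ql; by exists k.
Qed.

(** Arrow introduction. The behaviour of [d] under application need not put [phi r] into [d], so
    tokens coming from [D] carry a separate membership condition. *)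
Lemma phi_realizes (q : expSystem B B) (d : set D) : isPoint d ->
  (forall w, isPoint w -> realizesAll (proj1_sig q.1) w ->
     realizes q.2 (appPoint d w)) ->
  (forall r : expSystem D D, q = expMap compEmb_emb r -> d (phi r)) ->
  realizes (phi q) d.
Proof.
rewrite {1}/phi /= => pd dq dr; case: (cPhiP q) => [[[j r] qr ->]|[n [l [ql ->]]]] /=.
  move=> y jy; have ij : j = i := projT1_eq jy.
  subst j; rewrite -(existT_inj jy); apply: dr.
  by rewrite expMap_compEmb.
move=> w pw lw; apply: dq => // t; rewrite ql => -[k kn <-].
exact: lw.
Qed.

(** The fundamental lemma of the logical relation, by induction on [M]; abstraction rests on
    [interp_beta]. *)
Lemma interp_realizes M (rho : env B) (rho' : env D) :
  (forall x, realizesAll (proj1_sig (rho x)) (proj1_sig (rho' x))) ->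
  realizesAll (interp M rho) (interp M rho').
Proof.
elim: M rho rho' => [x|M IHM N IHN|y M IHM] rho rho' le; first exact: le.
  move=> t [a [az [F [fF Fu [cF eF]]]]].
  have pN := interp_point N rho'.
  apply: realizes_ent eF; first exact: isPoint_appPoint (interp_point M rho') pN.
  move=> _ [p [Fp ep] <-]; apply: realizes_phi => //.
    by apply: IHM; last exact: Fu.
  move=> s /ep eas; apply: (realizes_ent pN _ eas) => r /az.
  exact: IHN.
apply: realizes_down; first exact: interp_point.
move=> _ [a [t [Mt ->]]].
have step w : isPoint w -> realizesAll (proj1_sig a) w ->
    forall pw : isPoint w, realizes t (interp M (upd rho' y (exist _ w pw))).
  move=> _ aw pw; apply: IHM Mt => x; rewrite /upd; case: eqP => _ //.
  exact: realizes_down.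
apply: phi_realizes; first exact: (interp_point (Lam y M)).
  move=> w pw aw; apply: realizes_mono (step w pw aw pw).
  exact: (@interp_beta _ M rho' y (exist _ w pw)).
(* The membership condition for a token coming from [D]: the induction hypothesis is used at the
   principal point of [r.1], which realizes [a]. *)
move=> r [aE tE]; apply: interp_Lam.
have ar : realizesAll (proj1_sig a) (proj1_sig (principal r.1)).
  rewrite aE => _ [x rx <-] z xz; rewrite -(existT_inj xz).
  exact: (sub_down (con_fin (proj2_sig r.1))).
have := step _ (proj2_sig (principal r.1)) ar (proj2_sig (principal r.1)).
by rewrite tE; apply.
Qed.

End SumCompletion.

(** * Reflecting equations to the summands, and the choice of the summands *)

Lemma eqHolds_summand (I : Type) (A : I -> iWeb) (i0 i : I) M N :
  closedTerm M -> closedTerm N ->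
  eqHolds (completionWeb (sumWeb A i0)) M N -> eqHolds (A i) M N.
Proof.
move=> cM cN BMN rho; set B := completionWeb _ in BMN.
pose bot (C : iWeb) : env C := fun=> principal (exist _ set0 (con0 C)).
have restr K : closedTerm K ->
    interp K rho = [set x | interp K (bot B) (@compEmb _ A i0 i x)].
  move=> cK; rewrite (interp_closed rho (bot (A i)) cK).
  rewrite eqEsubset; split=> x.
    apply: (@interp_emb _ _ _ (@compEmb_emb _ A i0 i)); first exact: phi_compEmb.
    by move=> j t; apply: (down_emb (@compEmb_emb _ A i0 i)).
  have bots j : realizesAll (proj1_sig (bot B j)) (proj1_sig (bot (A i) j)).
    by apply: realizes_down; [exact: proj2_sig|].
  (* At a leaf of summand [i], being realized is membership. *)
  by move=> /(interp_realizes bots) /(_ _ erefl).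
by rewrite (restr M cM) (restr N cN) BMN.
Qed.

(** The one-token web is the default summand for equations that hold in every i-model. *)
Definition unitSystem : infoSystem.
Proof.
by refine (@InfoSystem unit (@finite_set unit) (fun a _ => finite_set a) tt
  _ _ _ _ _ _ _ _).
Defined.

Lemma unit_bMorphism :
  bMorphism (fun _ : expSystem unitSystem unitSystem => tt : unitSystem).
Proof.
have cF (a : set (expSystem unitSystem unitSystem)) : finite_set a -> con a.
  by move=> fa; split=> // t ta _; apply: finite_image; exact: sub_finite_set fa.
split=> [a fa|a t ca _].
  by split=> _; [exact: finite_image|exact: cF].
split=> //; apply: finite_image; apply: (@sub_finite_set _ _ a) => [p []//|].
exact: con_finite ca.
Qed.

Definition unitWeb : iWeb := IWeb unit_bMorphism.

Theorem mainTheorem7 : exists B : iWeb, forall M N : term,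
  closedTerm M -> closedTerm N -> (eqHolds B M N <-> forall A : iWeb, eqHolds A M N).
Proof.
(* Indexing by pairs of terms instead of by webs keeps the sum small; one refuting web per pair is
   enough. *)
have /choice[A AP] : forall e : term * term, exists A : iWeb,
    eqHolds A e.1 e.2 -> forall A' : iWeb, eqHolds A' e.1 e.2.
  move=> e; have [all|/existsNP[A nA]] :=
    pselect (forall A : iWeb, eqHolds A e.1 e.2); first by exists unitWeb.
  by exists A.
(* [(Var 0, Var 0)] is an arbitrary index, fixing the summand whose [nu] is that of the sum. *)
exists (completionWeb (sumWeb A (Var 0, Var 0))) => M N cM cN.
split=> [/(eqHolds_summand (i := (M, N)) cM cN)|]; first exact: AP.
exact.
Qed.
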